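(* Let $\mathfrak{F}$ be a surface in $E^3$ of class $C^r$, $r\ge 4$, without parabolic points and which is not a canal surface, with principal curvatures $k_1,k_2$. Consider the two nets on $\mathfrak{F}$ corresponding to the asymptotic lines of the central surfaces $\mathfrak{F}^{(1)}$ and $\mathfrak{F}^{(2)}$, respectively, namely $$\nabla_1 k_1\,\omega_1^2-\nabla_1k_2\,\omega_2^2=0\qquad\text{and}\qquad \nabla_2 k_1\,\omega_1^2-\nabla_2k_2\,\omega_2^2=0 .$$ These nets are both (a) orthogonal if and only if $\mathfrak{F}$ is a W-surface satisfying $k_1-k_2=\text{const.}$, and (b) conjugate if and only if $\mathfrak{F}$ is a W-surface satisfying $\dfrac{k_1}{k_2}=\text{const.}$
   Context: Setting. $\bar x(u,v)$ is a parametric representation of $\mathfrak{F}$ over a connected domain. $\{\bar e_1,\bar e_2,\bar e_3\}$ is the orthonormal moving frame with $\bar e_1,\bar e_2$ the principal directions, $\bar e_3$ the unit normal, $\det(\bar e_1,\bar e_2,\bar e_3)=1$. The linear differential forms $\omega_1,\omega_2,\omega_{ij}$ are defined by $d\bar x=\omega_1\bar e_1+\omega_2\bar e_2$, $d\bar e_i=\sum_{j}\omega_{ij}\bar e_j$ ($\omega_{ij}=-\omega_{ji}$), and $\omega_{31}=-k_1\omega_1$, $\omega_{32}=-k_2\omega_2$, where $k_1,k_2$ are the principal curvatures. For a function $f$, the Pfaffian derivatives $\nabla_1 f,\nabla_2 f$ are defined by $df=\nabla_1 f\,\omega_1+\nabla_2 f\,\omega_2$. Standing assumptions. $\mathfrak{F}$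 has no parabolic points: $k_1k_2\neq 0$ everywhere. $\mathfrak{F}$ is not a canal surface, so that the central surfaces do not degenerate into curves; this is used in the form $k_1\neq k_2$, $\nabla_1k_1\neq 0$ and $\nabla_2k_2\neq0$ everywhere. Central surfaces. $\mathfrak{F}^{(i)}$, $i=1,2$, is the surface parametrized by $\bar y^{(i)}=\bar x+\frac{1}{k_i}\bar e_3$; points of $\mathfrak{F}$ and $\mathfrak{F}^{(i)}$ with the same parameters $(u,v)$ correspond to each other. The asymptotic lines of $\mathfrak{F}^{(i)}$ are the null-curves of its second fundamental form. Nets. A net on $\mathfrak{F}$ is given by a quadratic differential equation $A\,\omega_1^2+2B\,\omega_1\omega_2+C\,\omega_2^2=0$ (its curves may be imaginary). It is orthogonal if its two directions are orthogonal with respect to the first fundamental form $\omega_1^2+\omega_2^2$, i.e. $A+C=0$; it is conjugate if its two directions are conjugate with respect to the second fundamental form $k_1\omega_1^2+k_2\omega_2^2$, i.e. $k_2A+k_1C=0$ (identically on $\mathfrak{F}$). A Weingarten surface (W-surface) is a surface for which there is a functional relation between $k_1$ and $k_2$. *)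

(* Defs.v *)
From HB Require Import structures.
From mathcomp Require Import all_boot all_order all_algebra.
From mathcomp Require Import all_classical all_reals all_analysis.
From mathcomp Require Import complex.

Set Implicit Arguments.
Unset Strict Implicit.
Unset Printing Implicit Defensive.

Import Order.TTheory GRing.Theory Num.Theory.
Import numFieldNormedType.Exports.

Local Open Scope classical_set_scope.
Local Open Scope ring_scope.
Local Open Scope complex_scope.

(* Parameters (u, v) range over R * R and E^3 is 'rV[R]_3.  A linear
   differential form is a function of a parameter p and of a parameter vector
   h = (du, dv). *)

(* f is of class C^n on the open set U; since 'd f p is linear, the clause for
   all h says that the partial derivatives are of class C^n. *)
Fixpoint of_class (R : realType) (V W : normedModType R) (n : nat)
    (U : set V) (f : V -> W) : Prop :=
  match n with
  | 0%N => forall p, U p -> {for p, continuous f}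
  | m.+1 => (forall p, U p -> differentiable f p) /\
            (forall h : V, of_class m U (fun p => 'd f p h))
  end.

Section Surfaces.
Variable R : realType.

Definition dot (a b : 'rV[R]_3) : R := \sum_(i < 3) a 0 i * b 0 i.

Definition immersed (U : set (R * R)) (x : R * R -> 'rV[R]_3) : Prop :=
  forall p, U p -> differentiable x p /\ (forall h, 'd x p h = 0 -> h = 0).

Definition unit_normal (U : set (R * R)) (x n : R * R -> 'rV[R]_3) : Prop :=
  forall p, U p -> [/\ differentiable n p, dot (n p) (n p) = 1
                     & forall h, dot ('d x p h) (n p) = 0].

(* The second fundamental form - dx . dn; for an immersed x, another choice of
   the unit normal n changes at most the sign. *)
Definition second_form (x n : R * R -> 'rV[R]_3) (p h : R * R) : R :=
  - dot ('d x p h) ('d n p h).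

Definition principal (U : set (R * R)) (x n e : R * R -> 'rV[R]_3)
    (k : R * R -> R) : Prop :=
  forall p, U p -> forall h, 'd x p h = e p -> 'd n p h = - k p *: e p.

(* An immersion of class C^r together with an adapted moving frame: e1, e2 are
   tangent (being orthogonal to the normal e3) and principal, with principal
   curvatures k1, k2, i.e. omega_31 = - k1 omega_1 and
   omega_32 = - k2 omega_2. *)
Record principal_frame (r : nat) (U : set (R * R))
    (x e1 e2 e3 : R * R -> 'rV[R]_3) (k1 k2 : R * R -> R) : Prop := {
  surface_class : of_class r U x;
  surface_immersed : immersed U x;
  frame_class : [/\ of_class (r - 2) U e1, of_class (r - 2) U e2
                  & of_class (r - 2) U e3];
  frame_normal : unit_normal U x e3;
  frame_unit : forall p, U p -> dot (e1 p) (e1 p) = 1 /\ dot (e2 p) (e2 p) = 1;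
  frame_orthogonal : forall p, U p ->
    [/\ dot (e1 p) (e2 p) = 0, dot (e1 p) (e3 p) = 0 & dot (e2 p) (e3 p) = 0];
  frame_positive : forall p, U p ->
    \det (col_mx (e1 p) (col_mx (e2 p) (e3 p)) : 'M[R]_3) = 1;
  frame_principal1 : principal U x e3 e1 k1;
  frame_principal2 : principal U x e3 e2 k2
}.

(* omega x e1 and omega x e2 are the forms in
   dx = omega_1 e1 + omega_2 e2. *)
Definition omega (x e : R * R -> 'rV[R]_3) (p h : R * R) : R :=
  dot ('d x p h) (e p).

(* The pair (nabla_1 f, nabla_2 f) at p, defined by
   df = nabla_1 f omega_1 + nabla_2 f omega_2; it is the only solution when
   omega_1, omega_2 are independent and f is differentiable at p. *)
Definition pfaffian (x e1 e2 : R * R -> 'rV[R]_3) (f : R * R -> R)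
    (p : R * R) : R * R :=
  get [set g : R * R | forall h,
         'd f p h = g.1 * omega x e1 p h + g.2 * omega x e2 p h].

Definition nabla1 x e1 e2 f p : R := (pfaffian x e1 e2 f p).1.
Definition nabla2 x e1 e2 f p : R := (pfaffian x e1 e2 f p).2.

Definition central_surface (x e3 : R * R -> 'rV[R]_3) (k : R * R -> R)
    (p : R * R) : 'rV[R]_3 :=
  x p + (k p)^-1 *: e3 p.

(* The net A omega_1^2 + 2 B omega_1 omega_2 + C omega_2^2 = 0. *)
Record net := Net { netA : R * R -> R; netB : R * R -> R; netC : R * R -> R }.

Definition net_form (x e1 e2 : R * R -> 'rV[R]_3) (N : net)
    (p h : R * R) : R :=
  netA N p * omega x e1 p h ^+ 2
  + 2 * netB N p * (omega x e1 p h * omega x e2 p h)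
  + netC N p * omega x e2 p h ^+ 2.

(* N is the net on x corresponding, through equal parameters, to the null
   curves of the second fundamental form of the surface y.  As these curves may
   be imaginary, equations are compared as quadratic forms up to a nowhere
   vanishing factor and not through their real zeros. *)
Definition asymptotic_net (U : set (R * R)) (x e1 e2 y : R * R -> 'rV[R]_3)
    (N : net) : Prop :=
  immersed U y /\
  exists (n : R * R -> 'rV[R]_3) (c : R * R -> R),
    unit_normal U y n /\
    forall p, U p -> c p != 0 /\
      forall h, second_form y n p h = c p * net_form x e1 e2 N p h.

(* d1, d2 are the (possibly imaginary) directions of N at p, by their
   components (omega_1, omega_2) in the complexified tangent plane: the
   quadratic form is the product of the linear forms vanishing on d1 and d2. *)
Definition net_directions (N : net) (p : R * R) (d1 d2 : R[i] * R[i]) : Prop :=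
  [/\ d1 != 0, d2 != 0 & forall h : R[i] * R[i],
     (netA N p)%:C * h.1 ^+ 2 + 2 * (netB N p)%:C * (h.1 * h.2)
     + (netC N p)%:C * h.2 ^+ 2
     = (d1.2 * h.1 - d1.1 * h.2) * (d2.2 * h.1 - d2.1 * h.2)].

(* Orthogonality for the first fundamental form omega_1^2 + omega_2^2; for a
   nonzero quadratic form it amounts to A + C = 0. *)
Definition orthogonal_net (U : set (R * R)) (N : net) : Prop :=
  forall p, U p -> exists d1 d2, net_directions N p d1 d2 /\
    d1.1 * d2.1 + d1.2 * d2.2 = 0.

(* Conjugacy for the second fundamental form k1 omega_1^2 + k2 omega_2^2; for a
   nonzero quadratic form it amounts to k2 A + k1 C = 0. *)
Definition conjugate_net (U : set (R * R)) (k1 k2 : R * R -> R)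
    (N : net) : Prop :=
  forall p, U p -> exists d1 d2, net_directions N p d1 d2 /\
    (k1 p)%:C * (d1.1 * d2.1) + (k2 p)%:C * (d1.2 * d2.2) = 0.

(* A functional relation Phi (k1, k2) = 0, with Phi of class C^1 near the image
   of (k1, k2) and d Phi nonzero along it. *)
Definition weingarten (U : set (R * R)) (k1 k2 : R * R -> R) : Prop :=
  exists (V : set (R * R)) (Phi : R * R -> R),
    [/\ open V, of_class 1 V Phi &
     forall p, U p -> [/\ V (k1 p, k2 p), Phi (k1 p, k2 p) = 0
                        & exists h, 'd Phi (k1 p, k2 p) h != 0]].

End Surfaces.

(* Main.v *)
(* The central surfaces have the principal directions as normals: e1 is normal to
   x + e3 / k1 and e2 to x + e3 / k2.  With omega_12 = de1 . e2, their second
   fundamental forms involve omega_12 only through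
     (k1 - k2) omega_12 = nabla_2 k1 omega_1 + nabla_1 k2 omega_2,
   the Codazzi equations, which turns them into the two nets up to the factors
   1 / k1 and - 1 / k2.  Orthogonality of both nets then says d k1 = d k2, and
   conjugacy says k2 d k1 = k1 d k2; on a connected domain this means that
   k1 - k2, respectively k1 / k2, is constant.  The Codazzi equations come from
   de3 . e1 = - k1 omega_1, differentiated once more and antisymmetrized. *)
From mathcomp Require Import complex ring lra.
Require Import Defs.
From HB Require Import structures.
From mathcomp Require Import all_boot all_order all_algebra.
From mathcomp Require Import all_classical all_reals all_analysis.
Import Order.TTheory GRing.Theory Num.Theory.
Import numFieldNormedType.Exports.
Local Open Scope classical_set_scope.
Local Open Scope ring_scope.

Set Implicit Arguments.
Unset Strict Implicit.
Unset Printing Implicit Defensive.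

(** * Differentiation rules in normed modules *)

Section Calculus.
Variables (R : realType) (V W : normedModType R).

Lemma near0_is_diff (g : V -> W) (p : V) :
  (\forall q \near p, g q = 0) -> is_diff p g 0.
Proof.
move=> g0.
have gE : g \o shift p = cst (g p) + 0 +o_ 0 id.
  apply/eqaddoP => _ /posnumP[e].
  move: g0; rewrite (near_shift 0) subr0 => g0.
  have -> : g p = 0 by have := nbhs_singleton g0; rewrite /= add0r.
  near=> h.
  have /= gh0 : (g \o shift p) h = 0 by near: h.
  rewrite -[leLHS]/(`|g (h + p) - (0 + 0)|) gh0 addr0 subrr normr0.
  by rewrite mulr_ge0.
have c0 : continuous (\0 : V -> W) by move=> q; exact: cvg_cst.
have d0 := diff_unique (df := \0) c0 gE.
by apply: DiffDef => //; apply/diff_locallyP; rewrite d0.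
Unshelve. all: by end_near. Qed.

(** The frame identities hold only on U, so derivatives have to be compared for functions that agree
    merely near p. The difference f - g vanishes near p and has derivative 0. *)
Lemma near_eq_is_diff (f g df : V -> W) (p : V) :
  (\forall q \near p, f q = g q) -> is_diff p g df -> is_diff p f df.
Proof.
move=> fg dg.
have d0 : is_diff p (f - g) 0.
  by apply: near0_is_diff; near do (rewrite -[LHS]/(_ - _); apply/eqP; rewrite subr_eq0; apply/eqP).
have -> : f = g + (f - g) by rewrite addrC subrK.
by apply: is_diff_eq; rewrite addr0.
Unshelve. all: by end_near. Qed.

Lemma is_diff_scale (k : V -> R) (f : V -> W) (p : V) :
  differentiable k p -> differentiable f p ->
  is_diff p (fun q => k q *: f q)
    (fun h => k p *: 'd f p h + 'd k p h *: f p).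
Proof.
move=> dk df.
(* Scaling is packed as a continuous bilinear map, so the product rule becomes the chain rule for
   this map after the pair (k, f). *)
have sb : bilinear_for
   (GRing.Scale.Law.clone _ _ *:%R _) (GRing.Scale.Law.clone _ _ *:%R _)
   (@GRing.scale R W).
  split=> [w|a] b u v /=; first by rewrite scalerDl scalerA.
  by rewrite scalerDr !scalerA mulrC.
pose sM := bilinear_isBilinear.Build R R W W _ _ _ sb.
pose sB : {bilinear R -> W -> W} := HB.pack (@GRing.scale R W) sM.
have sc : continuous (fun q : R * W => sB q.1 q.2) by exact: scale_continuous.
have dB := @differentiable_bilin _ _ _ _ sB (k p, f p) sc.
have dp := differentiable_pair dk df.
have -> : (fun q => k q *: f q) =
  (fun q => sB q.1 q.2) \o (fun q => (k q, f q)) by [].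
apply: DiffDef; first exact: differentiable_comp.
by rewrite diff_comp// (diff_bilin (k p, f p) sc) diff_pair.
Qed.

Lemma is_derive_line (g : V -> W) (d : V -> W) (p h : V) (t : R) :
  is_diff (p + t *: h) g d ->
  is_derive t (1 : R) (fun s : R => g (p + s *: h)) (d h).
Proof.
move=> dg.
have dl : is_diff t (fun s : R => p + s *: h) (fun s => s *: h).
  have -> : (fun s : R => p + s *: h) = cst p + ( *:%R^~ h) by [].
  by apply: is_diff_eq; rewrite add0r.
have dgl : is_diff t (g \o (fun s : R => p + s *: h)) (d \o (fun s => s *: h)).
  exact: is_diff_comp.
apply: DeriveDef; first exact: diff_derivable.
by rewrite deriveE// diff_val /= scale1r.
Qed.

End Calculus.

(** * Mean value theorem along segments and symmetry of second derivatives *)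

Section MeanValue.
Variables (R : realType) (V : normedModType R).

Lemma line_MVT (g : V -> R) (D : V -> V -> R) (p h : V) (t : R) :
  0 < t -> (forall s, 0 <= s <= t -> is_diff (p + s *: h) g (D (p + s *: h))) ->
  exists2 s, 0 <= s <= t & g (p + t *: h) - g p = D (p + s *: h) h * t.
Proof.
move=> t0 dg.
have dl s : 0 <= s <= t ->
    is_derive s (1 : R) (fun s : R => g (p + s *: h)) (D (p + s *: h) h).
  by move=> /dg /is_derive_line.
have [||s] := @MVT _ (fun s : R => g (p + s *: h)) (fun s => D (p + s *: h) h) _ _ t0.
- by move=> s; rewrite in_itv /= => /andP[/ltW s0 /ltW st]; apply: dl; rewrite s0.
- apply: derivable_within_continuous => s; rewrite in_itv /= => st.
  by have [] := dl _ st.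
rewrite in_itv /= => /andP[/ltW s0 /ltW st] E.
exists s; first by rewrite s0.
by move: E; rewrite scale0r addr0 subr0.
Qed.

(** The mean value theorem is applied twice: along h to q |-> g (q + t k) - g q, then along k to the
    derivative of g in direction h. *)
Lemma second_difference (U : set V) (g : V -> R) (D : V -> V -> R)
    (D2 : V -> V -> V -> R) (p h k : V) (t : R) :
  0 < t ->
  (forall a b, 0 <= a <= t -> 0 <= b <= t -> U (p + a *: h + b *: k)) ->
  (forall q, U q -> is_diff q g (D q)) ->
  (forall q, U q -> is_diff q (D^~ h) (D2 q h)) ->
  exists a b, [/\ 0 <= a <= t, 0 <= b <= t &
    g (p + t *: h + t *: k) - g (p + t *: h) - (g (p + t *: k) - g p)
    = D2 (p + a *: h + b *: k) h k * t * t].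
Proof.
move=> t0 inU dg dD.
have t01 : 0 <= (0 : R) <= t by rewrite lexx ltW.
have t11 : 0 <= t <= t by rewrite lexx ltW.
have [|a at1 E] := @line_MVT (fun q => g (q + t *: k) - g q)
    (fun q => D (q + t *: k) - D q) p h t t0.
  move=> a a01.
  have d1 : is_diff (p + a *: h + t *: k) g (D (p + a *: h + t *: k)) by apply/dg/inU.
  have d0 : is_diff (p + a *: h) g (D (p + a *: h)).
    by apply/dg; have := inU _ _ a01 t01; rewrite scale0r addr0.
  have ds : is_diff (p + a *: h) (shift (t *: k)) id.
    have -> : shift (t *: k) = id + cst (t *: k) by [].
    by apply: is_diff_eq; rewrite addr0.
  have dgs : is_diff (p + a *: h) (g \o shift (t *: k)) (D (p + a *: h + t *: k) \o id).
    exact: is_diff_comp.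
  exact: is_diffB.
have [|b bt E'] := @line_MVT (D^~ h) (fun q => D2 q h) (p + a *: h) k t t0.
  by move=> b b01; apply/dD/inU.
exists a, b; split=> //.
rewrite -E' -[D _ h - D _ h]/((D _ - D _) h) -E.
by rewrite addrAC.
Qed.

(* The second difference over a small square is symmetric in h and k, and t^2
   times each of the two mixed derivatives at nearby points. *)
Lemma second_diff_sym (U : set V) (g : V -> R) (D : V -> V -> R)
    (D2 : V -> V -> V -> R) (p h k : V) :
  open U -> U p ->
  (forall q, U q -> is_diff q g (D q)) ->
  (forall v q, U q -> is_diff q (D^~ v) (D2 q v)) ->
  (forall v w, {for p, continuous (fun q => D2 q v w)}) ->
  D2 p h k = D2 p k h.
Proof.
move=> oU Up dg dD cD2; apply/eqP; rewrite -subr_eq0 -normr_le0.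
apply/ler_addgt0Pr => _ /posnumP[e]; rewrite add0r.
have : \forall q \near p, [/\ U q, `|D2 p h k - D2 q h k| < e%:num / 2 &
                                  `|D2 p k h - D2 q k h| < e%:num / 2].
  have e2 : 0 < e%:num / 2 :> R by [].
  have := cD2 h k; move=> /cvgrPdist_lt /(_ _ e2) H1.
  have := cD2 k h; move=> /cvgrPdist_lt /(_ _ e2) H2.
  by near=> q; split; near: q => //; exact: open_nbhs_nbhs.
move=> /nbhs_ballP[d /= d0 pd].
(* With this side the whole parallelogram spanned by t h and t k at p stays in the ball of radius d;
   the summand 1 keeps the denominator positive when h = k = 0. *)
pose t := d / (`|h| + `|k| + 1).
have N0 : 0 < `|h| + `|k| + 1 by rewrite ltr_pwDr// addr_ge0.
have t0 : 0 < t by rewrite divr_gt0.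
have inb a b : 0 <= a <= t -> 0 <= b <= t -> ball p d (p + a *: h + b *: k).
  move=> /andP[a0 at1] /andP[b0 bt1]; rewrite -ball_normE /= -addrA opprD addNKr normrN.
  rewrite (le_lt_trans (ler_normD _ _))// !normrZ !ger0_norm//.
  rewrite (@le_lt_trans _ _ (t * (`|h| + `|k|)))//.
    by rewrite mulrDr lerD// ler_wpM2r.
  by rewrite /t mulrAC ltr_pdivrMr// ltr_pM2l// ltrDl.
have inb' a b : 0 <= a <= t -> 0 <= b <= t -> ball p d (p + a *: k + b *: h).
  by move=> a1 b1; rewrite addrAC; exact: inb.
have [|a [b [/inb ia /ia{}ia E]]] := @second_difference U g D D2 p h k t t0 _ dg (dD h).
  by move=> a b /inb ia /ia /pd [].
have [|a' [b' [/inb' ia' /ia'{}ia' E']]] := @second_difference U g D D2 p k h t t0 _ dg (dD k).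
  by move=> a' b' /inb' ia' /ia' /pd [].
have t1 : t != 0 by rewrite gt_eqF.
(* Both sides times t^2 are the same second difference, and t is nonzero. *)
have EE : D2 (p + a *: h + b *: k) h k = D2 (p + a' *: k + b' *: h) k h.
  apply: (mulIf t1); apply: (mulIf t1); rewrite -E -E' (addrAC p (t *: h)); ring.
have [_ I _] := pd _ ia; have [_ _ I'] := pd _ ia'.
rewrite -(subrKA (D2 (p + a *: h + b *: k) h k)) {2}EE.
rewrite (le_trans (ler_normD _ _))// (splitr e%:num) lerD// ltW//.
by rewrite distrC.
Unshelve. all: by end_near. Qed.

End MeanValue.

(** * Functions with zero derivative on a connected open set *)

Section Constancy.
Variables (R : realType) (V : normedModType R).

(** The mean value theorem on balls makes g locally constant; connectedness then leaves room for a
    single value. *)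
Lemma diff0_cst (U : set V) (g : V -> R) : open U -> connected U ->
  (forall p, U p -> is_diff p g 0) -> exists c, forall p, U p -> g p = c.
Proof.
move=> oU cU dg.
have [[p0 Up0]|nU] := pselect (U !=set0); last first.
  by exists 0 => p Up; case: nU; exists p.
have loc p : U p -> \forall q \near p, U q /\ g q = g p.
  move=> Up; have /nbhs_ballP[d /= d0 dU] : nbhs p U by exact: open_nbhs_nbhs.
  apply/nbhs_ballP; exists d => //= q pq; split; first exact: dU.
  have [|s s1] := @line_MVT _ _ g (fun=> 0) p (q - p) 1 ltr01.
    move=> s /andP[s0 s1]; apply/dg/dU; move: pq.
    rewrite -!ball_normE /= opprD addNKr normrN normrZ distrC ger0_norm//.
    by apply: le_lt_trans; rewrite ler_piMl.
  by rewrite scale1r subrKC /= mul0r => /subr0_eq.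
exists (g p0); pose B := [set p | U p /\ g p = g p0].
suff BU : B = U by move=> p; rewrite -BU => -[].
(* It remains that the level set B of the value at p0 is nonempty, open in U and closed in U; the
   last holds because its complement C in U is open. *)
apply: cU.
- by exists p0.
- exists B; last by apply/seteqP; split=> [p []|p []].
  rewrite openE => p [Up gp]; near=> q.
  have [Uq gq] : U q /\ g q = g p by near: q; exact: loc.
  by split=> //; rewrite gq.
- pose C := [set p | U p /\ g p != g p0].
  exists (~` C); last first.
    apply/seteqP; split=> [p [Up gp]|p [Up nC]]; split=> //.
      by move=> [_]; rewrite gp eqxx.
    by apply/eqP/negPn/negP => gp; apply: nC.
  apply: open_closedC; rewrite openE => p [Up gp]; near=> q.
  have [Uq gq] : U q /\ g q = g p by near: q; exact: loc.
  by split=> //; rewrite gq.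
Unshelve. all: by end_near. Qed.

End Constancy.

(** * Linear algebra of the scalar product and of pairs of linear forms *)

Section Dot.
Variable R : realType.
Implicit Types u v w : 'rV[R]_3.

Lemma dotC u v : dot u v = dot v u.
Proof. by apply: eq_bigr => i _; rewrite mulrC. Qed.

Lemma dotDl u v w : dot (u + v) w = dot u w + dot v w.
Proof. by rewrite -big_split; apply: eq_bigr => i _; rewrite mxE mulrDl. Qed.

Lemma dotZl a u w : dot (a *: u) w = a * dot u w.
Proof. by rewrite /dot big_distrr /=; apply: eq_bigr => i _; rewrite mxE mulrA. Qed.

Lemma dotDr u v w : dot u (v + w) = dot u v + dot u w.
Proof. by rewrite dotC dotDl !(dotC u). Qed.

Lemma dotZr a u w : dot u (a *: w) = a * dot u w.
Proof. by rewrite dotC dotZl dotC. Qed.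

(** The matrix M with rows e1, e2, e3 satisfies M M^T = 1, hence also M^T M = 1, and v = (v M^T) M
    is the expansion sought. *)
Lemma orthonormal_basis (e1 e2 e3 v : 'rV[R]_3) :
  dot e1 e1 = 1 -> dot e2 e2 = 1 -> dot e3 e3 = 1 ->
  dot e1 e2 = 0 -> dot e1 e3 = 0 -> dot e2 e3 = 0 ->
  v = dot v e1 *: e1 + dot v e2 *: e2 + dot v e3 *: e3.
Proof.
move=> e11 e22 e33 e12 e13 e23.
pose e (i : 'I_3) : 'rV[R]_3 := if val i is 0%N then e1 else if val i is 1%N then e2 else e3.
pose M : 'M[R]_3 := \matrix_(i, j) e i 0 j.
have MMT : M *m M^T = 1%:M.
  apply/matrixP => i j; rewrite !mxE.
  transitivity (dot (e i) (e j)); first by apply: eq_bigr => k _; rewrite !mxE.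
  have e21 := e12; have e31 := e13; have e32 := e23.
  rewrite dotC in e21; rewrite dotC in e31; rewrite dotC in e32.
  rewrite -val_eqE /e; case: i j => -[|[|[|//]]] ? [[|[|[|//]]] ?];
    by rewrite /= ?e11 ?e22 ?e33 ?e12 ?e13 ?e23 ?e21 ?e31 ?e32.
have {1}-> : v = v *m M^T *m M by rewrite -mulmxA (mulmx1C MMT) mulmx1.
have vE i : (v *m M^T) 0 i = dot v (e i).
  by rewrite mxE; apply: eq_bigr => k _; rewrite !mxE.
apply/rowP => j; rewrite mxE !big_ord_recl big_ord0 !vE !mxE addr0 /e /=.
by rewrite addrA.
Qed.

Lemma linear_plane_basis (f g : {linear (R * R)%type -> R}) :
  (forall h, f h = 0 -> g h = 0 -> h = 0) ->
  exists h1 h2, [/\ f h1 = 1, g h1 = 0, f h2 = 0 & g h2 = 1].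
Proof.
move=> inj.
have lE (l : {linear (R * R)%type -> R}) a b : l (a, b) = a * l (1, 0) + b * l (0, 1).
  have -> : (a, b) = a *: (1, 0) + b *: (0, 1) :> R * R.
    by rewrite -[RHS]/(a * 1 + b * 0, a * 0 + b * 1) !mulr1 !mulr0 addr0 add0r.
  by rewrite linearD !linearZ.
(* D is the determinant of the pair (f, g). If it vanished, f and g would both kill (f (0, 1), - f
   (1, 0)), so f = 0; then likewise g = 0, against the trivial common kernel. The dual basis below
   is Cramer's rule. *)
pose D := f (1, 0) * g (0, 1) - f (0, 1) * g (1, 0).
have D0 : D != 0.
  apply/negP => /eqP D0.
  have [] : (f (0, 1), - f (1, 0)) = 0 :> R * R.
    by apply: inj; rewrite lE; [ring | transitivity (- D); [rewrite /D; ring | rewrite D0 oppr0]].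
  move=> f01 /eqP; rewrite oppr_eq0 => /eqP f10.
  have [] : (g (0, 1), - g (1, 0)) = 0 :> R * R.
    by apply: inj; rewrite lE ?f01 ?f10; ring.
  move=> g01 /eqP; rewrite oppr_eq0 => /eqP g10.
  have [/eqP] : (1, 0) = 0 :> R * R by apply: inj.
  by rewrite oner_eq0.
exists (g (0, 1) / D, - g (1, 0) / D), (- f (0, 1) / D, f (1, 0) / D).
by split; rewrite lE; move: D0; rewrite /D => D0; field.
Qed.

End Dot.

(** * Derivatives of scalar products *)

Section DotCalculus.
Variables (R : realType) (V : normedModType R).

Lemma is_diff_coord (f df : V -> 'rV[R]_3) (p : V) :
  is_diff p f df -> forall i : 'I_3, is_diff p (fun q => f q 0 i) (fun h => df h 0 i).
Proof.
move=> dfp i.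
have @c : {linear 'rV[R]_3 -> R}.
  by exists (fun N : 'rV[R]_3 => N 0 i); do 2![eexists]; do ?[constructor];
     rewrite ?mxE// => ? *; rewrite ?mxE//; move=> ?; rewrite !mxE.
have cc : continuous c by exact: coord_continuous.
have dc : is_diff (f p) c c.
  by apply: DiffDef; [exact: linear_differentiable | exact: diff_lin].
exact: (is_diff_comp dfp dc).
Qed.

Lemma is_diff_dot (f g df dg : V -> 'rV[R]_3) (p : V) :
  is_diff p f df -> is_diff p g dg ->
  is_diff p (fun q => dot (f q) (g q))
    (fun h => dot (df h) (g p) + dot (f p) (dg h)).
Proof.
move=> dfp dgp.
pose P i := (fun q => f q 0 i) * (fun q => g q 0 i) : V -> R.
pose dP i : V -> R := f p 0 i *: (fun h => dg h 0 i) + g p 0 i *: (fun h => df h 0 i).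
have dPi i : is_diff p (P i) (dP i).
  exact: is_diffM (is_diff_coord dfp i) (is_diff_coord dgp i).
have -> : (fun q => dot (f q) (g q)) = P 0 + P (lift 0 0) + P (lift 0 (lift 0 0)).
  by apply/funext => q; rewrite /dot !big_ord_recl big_ord0 addr0 addrA.
apply: is_diff_eq; apply/funext => h.
rewrite /dot !big_ord_recl !big_ord0 /dP.
rewrite -[LHS]/((f p 0 _ * dg h 0 _ + g p 0 _ * df h 0 _) +
  (f p 0 _ * dg h 0 _ + g p 0 _ * df h 0 _) + (f p 0 _ * dg h 0 _ + g p 0 _ * df h 0 _)).
ring.
Qed.

Lemma diff_dot (f g : V -> 'rV[R]_3) (p : V) :
  differentiable f p -> differentiable g p ->
  is_diff p (fun q => dot (f q) (g q))
    (fun h => dot ('d f p h) (g p) + dot (f p) ('d g p h)).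
Proof. by move=> /differentiableP df /differentiableP dg; exact: is_diff_dot. Qed.

End DotCalculus.

(** * Differentiability classes and mixed derivatives of vector-valued maps *)

Lemma of_class_le (R : realType) (V W : normedModType R) (U : set V)
  (m n : nat) (f : V -> W) : (m <= n)%N -> of_class n U f -> of_class m U f.
Proof.
have of_classW l (g : V -> W) : of_class l.+1 U g -> of_class l U g.
  elim: l g => [g [dg _] p Up|l IH g [dg cg]].
    exact/differentiable_continuous/dg.
  by split=> // h; apply/IH/cg.
move=> /subnK <-; elim: (n - m)%N => [//|l IH].
by rewrite addSn => /of_classW.
Qed.

(** Schwarz's theorem, obtained coordinate by coordinate from the scalar case; class 2 supplies the
    continuity of the second derivatives at p. *)
Lemma diff_diffC (R : realType) (V : normedModType R) (U : set V)
    (f : V -> 'rV[R]_3) (p h k : V) :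
  open U -> of_class 2 U f -> U p ->
  'd (fun q => 'd f q h) p k = 'd (fun q => 'd f q k) p h.
Proof.
move=> oU [df d2f] Up; apply/rowP => i.
apply: (@second_diff_sym _ _ U (fun q => f q 0 i) (fun q v => 'd f q v 0 i)
  (fun q v w => 'd (fun r => 'd f r v) q w 0 i) p h k oU Up).
- by move=> q Uq; exact/is_diff_coord/differentiableP/df.
- move=> v q Uq; have [dd _] := d2f v.
  exact: (is_diff_coord (differentiableP (dd _ Uq))).
- move=> v w; have [_ /(_ w p Up) c] := d2f v.
  exact: (continuous_comp c (@coord_continuous _ _ _ _ _ _)).
Qed.

(** * The moving frame and its structure equations *)

Section Frame.
Variable R : realType.
Implicit Types (U : set (R * R)) (x e : R * R -> 'rV[R]_3) (k : R * R -> R).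

(* Unlike principal_frame, which fixes the orientation, this is symmetric in the
   indices 1 and 2, so each result about e1, k1 also holds for e2, k2. *)
Record adapted_frame U x e1 e2 e3 k1 k2 : Prop := {
  adapted_open : open U;
  adapted_class : [/\ of_class 2 U x, of_class 1 U e1, of_class 1 U e2
                    & of_class 2 U e3];
  adapted_immersed : immersed U x;
  adapted_normal : unit_normal U x e3;
  adapted_unit : forall p, U p -> dot (e1 p) (e1 p) = 1 /\ dot (e2 p) (e2 p) = 1;
  adapted_orthogonal : forall p, U p ->
    [/\ dot (e1 p) (e2 p) = 0, dot (e1 p) (e3 p) = 0 & dot (e2 p) (e3 p) = 0];
  adapted_principal : principal U x e3 e1 k1 /\ principal U x e3 e2 k2
}.

Lemma adapted_frameC U x e1 e2 e3 k1 k2 :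
  adapted_frame U x e1 e2 e3 k1 k2 -> adapted_frame U x e2 e1 e3 k2 k1.
Proof.
case=> oU [cx c1 c2 c3] ix n3 un og [p1 p2]; split=> //.
  by move=> p /un [].
by move=> p /og [? ? ?]; rewrite dotC.
Qed.

Lemma principal_frame_adapted r U x e1 e2 e3 k1 k2 : (4 <= r)%N -> open U ->
  principal_frame r U x e1 e2 e3 k1 k2 -> adapted_frame U x e1 e2 e3 k1 k2.
Proof.
move=> r4 oU [cx ix [c1 c2 c3] n3 un og _ p1 p2].
(* The bound r >= 4 makes [e3], of class r - 2, twice differentiable, as the Codazzi equations
   require. *)
have r2 : (2 <= r - 2)%N by rewrite leq_subRL ?(leq_trans _ r4).
split=> //; split.
- by apply: of_class_le cx; exact: leq_trans r4.
- by apply: of_class_le c1; exact: ltnW.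
- by apply: of_class_le c2; exact: ltnW.
- exact: of_class_le c3.
Qed.

Lemma omega_linear x e p : scalar (omega x e p).
Proof. by move=> a h l; rewrite /omega linearP dotDl dotZl. Qed.

(** Applied to the orthonormality relations of the frame, this yields omega_ij = - omega_ji. *)
Lemma dot_cst_diff U (f g : R * R -> 'rV[R]_3) (c : R) p h : open U -> U p ->
  differentiable f p -> differentiable g p ->
  (forall q, U q -> dot (f q) (g q) = c) ->
  dot ('d f p h) (g p) + dot (f p) ('d g p h) = 0.
Proof.
move=> oU Up df dg fgc.
have [_ E] := diff_dot df dg.
have [_ E0] : is_diff p (fun q => dot (f q) (g q)) 0.
  apply: (@near_eq_is_diff _ _ _ _ (cst c)).
  by near=> q; apply: fgc; near: q; exact: open_nbhs_nbhs.
by have := congr1 (@^~ h) E; rewrite E0.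
Unshelve. all: by end_near. Qed.

Section AtPoint.
Variables (U : set (R * R)) (x e1 e2 e3 : R * R -> 'rV[R]_3).
Variables (k1 k2 : R * R -> R) (F : adapted_frame U x e1 e2 e3 k1 k2).
Variables (p : R * R) (Up : U p).

Lemma diff_tangent h :
  'd x p h = omega x e1 p h *: e1 p + omega x e2 p h *: e2 p.
Proof.
have [e11 e22] := adapted_unit F Up; have [e12 e13 e23] := adapted_orthogonal F Up.
have [_ e33 n3] := adapted_normal F Up.
by rewrite {1}(orthonormal_basis ('d x p h) e11 e22 e33 e12 e13 e23) n3 scale0r addr0.
Qed.

(* h1, h2 is the basis dual to omega_1, omega_2, so that nabla_i f = df (h_i). *)
Lemma frame_basis : exists h1 h2, [/\ 'd x p h1 = e1 p, 'd x p h2 = e2 p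
  & forall h, h = omega x e1 p h *: h1 + omega x e2 p h *: h2].
Proof.
have [_ injx] := adapted_immersed F Up.
pose L1 : {linear (R * R)%type -> R} :=
  HB.pack (omega x e1 p) (GRing.isLinear.Build _ _ _ _ _ (omega_linear x e1 p)).
pose L2 : {linear (R * R)%type -> R} :=
  HB.pack (omega x e2 p) (GRing.isLinear.Build _ _ _ _ _ (omega_linear x e2 p)).
have inj h : omega x e1 p h = 0 -> omega x e2 p h = 0 -> h = 0.
  by move=> o1 o2; apply: injx; rewrite diff_tangent o1 o2 !scale0r addr0.
have [h1 [h2 [w11 w21 w12 w22]]] := @linear_plane_basis _ L1 L2 inj.
rewrite /L1 /L2 /= in w11 w21 w12 w22.
exists h1, h2; split.
- by rewrite diff_tangent w11 w21 scale1r scale0r addr0.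
- by rewrite diff_tangent w12 w22 scale1r scale0r add0r.
- move=> h; apply/subr0_eq/inj.
  + rewrite -[LHS]/(L1 _) linearB linearD !linearZ /= w11 w12.
    by rewrite scaler0 [_ *: 1]mulr1 addr0 subrr.
  + rewrite -[LHS]/(L2 _) linearB linearD !linearZ /= w21 w22.
    by rewrite scaler0 [_ *: 1]mulr1 add0r subrr.
Qed.

End AtPoint.
End Frame.

(** Rodrigues' formula: [principal] gives it on the dual basis h1, h2, and linearity extends it to
    every h. *)
Lemma diff_normal (R : realType) (U : set (R * R)) (x e1 e2 e3 : R * R -> 'rV[R]_3)
    (k1 k2 : R * R -> R) (p h : R * R) :
  adapted_frame U x e1 e2 e3 k1 k2 -> U p ->
  'd e3 p h = - (k1 p * omega x e1 p h) *: e1 p + - (k2 p * omega x e2 p h) *: e2 p.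
Proof.
move=> F Up; have [P1 P2] := adapted_principal F.
have [h1 [h2 [xh1 xh2 h_decomp]]] := frame_basis F Up.
transitivity (omega x e1 p h *: 'd e3 p h1 + omega x e2 p h *: 'd e3 p h2).
  by rewrite {1}[h]h_decomp linearD !linearZ.
rewrite (P1 p Up _ xh1) (P2 p Up _ xh2).
have sE (a b : R) (w : 'rV[R]_3) : a *: (- b *: w) = - (b * a) *: w.
  by rewrite scalerA mulrN mulrC.
by rewrite !sE.
Qed.

Lemma dot_diff_normal (R : realType) (U : set (R * R)) (x e1 e2 e3 : R * R -> 'rV[R]_3)
    (k1 k2 : R * R -> R) (p h : R * R) :
  adapted_frame U x e1 e2 e3 k1 k2 -> U p ->
  dot ('d e3 p h) (e1 p) = - (k1 p * omega x e1 p h).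
Proof.
move=> F Up; rewrite (diff_normal _ F Up) dotDl !dotZl.
have [-> _] := adapted_unit F Up; have [e12 _ _] := adapted_orthogonal F Up.
by rewrite (dotC (e2 p)) e12 mulr0 addr0 mulr1.
Qed.

Lemma dot_diff_normal_l (R : realType) (U : set (R * R)) (x e1 e2 e3 : R * R -> 'rV[R]_3)
    (k1 k2 : R * R -> R) (p h : R * R) (v : 'rV[R]_3) :
  adapted_frame U x e1 e2 e3 k1 k2 -> U p ->
  dot ('d e3 p h) v
  = - (k1 p * omega x e1 p h) * dot (e1 p) v + - (k2 p * omega x e2 p h) * dot (e2 p) v.
Proof. by move=> F Up; rewrite (diff_normal h F Up) dotDl !dotZl. Qed.

Lemma dot_diff_tangent_l (R : realType) (U : set (R * R)) (x e1 e2 e3 : R * R -> 'rV[R]_3)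
    (k1 k2 : R * R -> R) (p h : R * R) (v : 'rV[R]_3) :
  adapted_frame U x e1 e2 e3 k1 k2 -> U p ->
  dot ('d x p h) v
  = omega x e1 p h * dot (e1 p) v + omega x e2 p h * dot (e2 p) v.
Proof. by move=> F Up; rewrite (diff_tangent F Up h) dotDl !dotZl. Qed.

(** These come from differentiating e1 . e1 = 1, e1 . e2 = 0 and e1 . e3 = 0; the last is combined
    with omega_31 = - k1 omega_1. *)
Lemma frame_skew (R : realType) (U : set (R * R)) (x e1 e2 e3 : R * R -> 'rV[R]_3)
    (k1 k2 : R * R -> R) (p h : R * R) : adapted_frame U x e1 e2 e3 k1 k2 -> U p ->
  [/\ dot (e1 p) ('d e1 p h) = 0, dot ('d e2 p h) (e1 p) = - dot ('d e1 p h) (e2 p)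
    & dot (e3 p) ('d e1 p h) = k1 p * omega x e1 p h].
Proof.
move=> F Up; have oU := adapted_open F.
have [_ [d1 _] [d2 _] [d3 _]] := adapted_class F; split.
- have := dot_cst_diff h oU Up (d1 p Up) (d1 p Up) (fun q Uq => (adapted_unit F Uq).1).
  by rewrite dotC; lra.
- have e12 q : U q -> dot (e1 q) (e2 q) = 0 by move=> /(adapted_orthogonal F)[].
  have := dot_cst_diff h oU Up (d1 p Up) (d2 p Up) e12.
  by rewrite (dotC (e1 p)); lra.
- have e13 q : U q -> dot (e1 q) (e3 q) = 0 by move=> /(adapted_orthogonal F)[].
  have E := dot_cst_diff h oU Up (d1 p Up) (d3 p Up) e13.
  rewrite dotC -[RHS]opprK -(dot_diff_normal h F Up) [in RHS]dotC.
  by apply/eqP; rewrite -addr_eq0; exact/eqP.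
Qed.

(** * Pfaffian derivatives in the dual basis *)

Section Dual.
Variable R : realType.
Variables (U : set (R * R)) (x e1 e2 e3 : R * R -> 'rV[R]_3).
Variables (k1 k2 : R * R -> R) (F : adapted_frame U x e1 e2 e3 k1 k2).
Variables (p : R * R) (Up : U p) (h1 h2 : R * R).
Hypotheses (xh1 : 'd x p h1 = e1 p) (xh2 : 'd x p h2 = e2 p).
Hypothesis h_decomp : forall h, h = omega x e1 p h *: h1 + omega x e2 p h *: h2.

Lemma omega_dual : [/\ omega x e1 p h1 = 1, omega x e2 p h1 = 0,
  omega x e1 p h2 = 0 & omega x e2 p h2 = 1].
Proof.
have [e11 e22] := adapted_unit F Up; have [e12 _ _] := adapted_orthogonal F Up.
by rewrite /omega xh1 xh2 (dotC (e2 p)).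
Qed.

Lemma diff_decomp (f : R * R -> R) h :
  'd f p h = 'd f p h1 * omega x e1 p h + 'd f p h2 * omega x e2 p h.
Proof.
by rewrite {1}[h]h_decomp linearD !linearZ mulrC (mulrC _ (omega x e2 p h)).
Qed.

(** The choice made by [get] satisfies the defining equation because [diff_decomp] exhibits a
    solution; evaluation at h1 and h2 then isolates its components. *)
Lemma nablaE (f : R * R -> R) :
  nabla1 x e1 e2 f p = 'd f p h1 /\ nabla2 x e1 e2 f p = 'd f p h2.
Proof.
have [w11 w21 w12 w22] := omega_dual.
have E h : 'd f p h = nabla1 x e1 e2 f p * omega x e1 p h
    + nabla2 x e1 e2 f p * omega x e2 p h.
  move: h; apply: (@getPex _ [set g : R * R | forall h,
    'd f p h = g.1 * omega x e1 p h + g.2 * omega x e2 p h]).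
  by exists ('d f p h1, 'd f p h2) => h; exact: diff_decomp.
by rewrite (E h1) (E h2) w11 w21 w12 w22 !mulr1 !mulr0 addr0 add0r.
Qed.

End Dual.

(** * Differentiability of the curvatures, Codazzi equations, tangents of the central surfaces *)

Section Curvature.
Variable R : realType.
Variables (U : set (R * R)) (x e1 e2 e3 : R * R -> 'rV[R]_3).
Variables (k1 k2 : R * R -> R) (F : adapted_frame U x e1 e2 e3 k1 k2).
Variables (p : R * R) (Up : U p).

(** For a fixed vector h1, k1 equals - (de3 (h1) . e1) / omega_1 (h1) near p, a quotient of
    differentiable functions. Since omega_1 (h1) is 1 at p, it stays nonzero nearby. *)
Lemma differentiable_curvature : differentiable k1 p.
Proof.
have [h1 [h2 [xh1 xh2 _]]] := frame_basis F Up.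
have [w11 _ _ _] := omega_dual F Up xh1 xh2.
have oU := adapted_open F.
have [[dx d2x] [d1 _] _ [d3 d2n]] := adapted_class F.
have [dxh _] := d2x h1; have [dnh _] := d2n h1.
have dO : differentiable (fun q => omega x e1 q h1) p.
  by have [] := diff_dot (dxh p Up) (d1 p Up).
have dN : differentiable (fun q => dot ('d e3 q h1) (e1 q)) p.
  by have [] := diff_dot (dnh p Up) (d1 p Up).
have O0 : \forall q \near p, omega x e1 q h1 != 0.
  have cO := differentiable_continuous dO.
  by apply: (cvgr_neq0 _ cO); rewrite w11 oner_eq0.
pose K : R * R -> R := - ((fun q => dot ('d e3 q h1) (e1 q)) * (fun q => (omega x e1 q h1)^-1)).
have O1 : omega x e1 p h1 != 0 by rewrite w11 oner_neq0.
have dK : differentiable K p.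
  exact: differentiableN (differentiableM dN (differentiableV dO O1)).
have [] // := @near_eq_is_diff _ _ _ k1 K _ p _ (differentiableP dK).
near=> q.
have Uq : U q by near: q; exact: open_nbhs_nbhs.
have Oq : omega x e1 q h1 != 0 by near: q.
rewrite -[RHS]/(- (dot ('d e3 q h1) (e1 q) * (omega x e1 q h1)^-1)).
by rewrite (dot_diff_normal _ F Uq) mulNr opprK mulfK.
Unshelve. all: by end_near. Qed.

(** This is nabla_2 k1 = (k1 - k2) omega_12 (h1). With h held constant, de3 (h) . e1 = - k1 omega_1
    (h) is differentiated in direction g, and the cases (h, g) = (h1, h2) and (h2, h1) are
    subtracted. *)
Lemma codazzi h1 h2 : 'd x p h1 = e1 p -> 'd x p h2 = e2 p ->
  'd k1 p h2 = (k1 p - k2 p) * dot ('d e1 p h1) (e2 p).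
Proof.
move=> xh1 xh2; have [w11 w21 w12 w22] := omega_dual F Up xh1 xh2.
have oU := adapted_open F.
have [cx [d1 _] _ c3] := adapted_class F.
have [dx d2x] := cx; have [dn d2n] := c3.
have dk := differentiable_curvature.
have split_terms (a b b' c d d' z : R) : a + b = - (k1 p * (c + d) + z) ->
    b = b' -> d = d' -> a + b' = - (k1 p * (c + d') + z) by move=> + <- <-.
have E h g n s : 'd (fun q => 'd e3 q h) p g = n -> 'd (fun q => 'd x q h) p g = s ->
    dot n (e1 p) - k2 p * omega x e2 p h * dot (e2 p) ('d e1 p g)
    = - (k1 p * (dot s (e1 p) + omega x e2 p h * dot (e2 p) ('d e1 p g))
         + omega x e1 p h * 'd k1 p g).
  have [dxh _] := d2x h; have [dnh _] := d2n h.
  have [_ EN] := diff_dot (dnh p Up) (d1 p Up).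
  have dO := diff_dot (dxh p Up) (d1 p Up).
  have dM := is_diffN (is_diffM (differentiableP dk) dO).
  have [|_ E'] := near_eq_is_diff _ dM (f := fun q => dot ('d e3 q h) (e1 q)).
    near=> q; have Uq : U q by near: q; exact: open_nbhs_nbhs.
    exact: dot_diff_normal F Uq.
  have [e1e1 _ _] := frame_skew g F Up.
  move=> <- <-; apply: split_terms.
  - transitivity ('d (fun q => dot ('d e3 q h) (e1 q)) p g); first by rewrite EN.
    by rewrite E'.
  - by rewrite (dot_diff_normal_l h _ F Up) e1e1 mulr0 add0r mulNr.
  - by rewrite (dot_diff_tangent_l h _ F Up) e1e1 mulr0 add0r.
(* Here n and s are the e1-components of the mixed second derivatives of [e3] and [x]. By symmetry
   the same two numbers occur in both orders; once they are abstracted, linear arithmetic eliminates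
   them. *)
have [n [s [E12 E21]]] : exists n s : R,
    n - k2 p * omega x e2 p h1 * dot (e2 p) ('d e1 p h2)
    = - (k1 p * (s + omega x e2 p h1 * dot (e2 p) ('d e1 p h2))
         + omega x e1 p h1 * 'd k1 p h2) /\
    n - k2 p * omega x e2 p h2 * dot (e2 p) ('d e1 p h1)
    = - (k1 p * (s + omega x e2 p h2 * dot (e2 p) ('d e1 p h1))
         + omega x e1 p h2 * 'd k1 p h1).
  exists (dot ('d (fun q => 'd e3 q h1) p h2) (e1 p)), (dot ('d (fun q => 'd x q h1) p h2) (e1 p)).
  by split; apply: E => //; exact: diff_diffC Up.
rewrite w11 w21 in E12; rewrite w12 w22 in E21; rewrite (dotC _ (e2 p)).
lra.
Unshelve. all: by end_near. Qed.

(** In d (x + e3 / k1) the e1-part omega_1 of dx cancels against - k1 omega_1 / k1 from de3, which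
    is why e1 is normal to the central surface. *)
Lemma is_diff_central : k1 p != 0 ->
  is_diff p (central_surface x e3 k1)
    (fun h => ((1 - k2 p / k1 p) * omega x e2 p h) *: e2 p
              + - ('d k1 p h / k1 p ^+ 2) *: e3 p).
Proof.
move=> k0; have dk := differentiable_curvature.
have [[dx _] _ _ [dn _]] := adapted_class F.
have dV := differentiableV dk k0.
have D := is_diffD (differentiableP (dx p Up)) (is_diff_scale dV (dn p Up)).
apply: is_diff_eq D _; apply/funext => h.
have subst_terms (a a' b b' : 'rV[R]_3) (c c' l : R) : a = a' -> b = b' -> c = c' ->
  a + (l *: b + c *: e3 p) = a' + (l *: b' + c' *: e3 p) by move=> -> -> ->.
have EV : 'd (fun q => (k1 q)^-1) p h = - (k1 p) ^- 2 * 'd k1 p h by rewrite (diffV dk k0).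
apply: etrans (subst_terms _ _ _ _ _ _ _ (diff_tangent F Up h) (diff_normal h F Up) EV) _.
by move: ('d k1 p h) => d; apply/rowP => i; rewrite !mxE; field.
Qed.

End Curvature.

(** * Asymptotic lines of the central surfaces *)

Section Central.
Variable R : realType.
Variables (U : set (R * R)) (x e1 e2 e3 : R * R -> 'rV[R]_3).
Variables (k1 k2 : R * R -> R).

Lemma central_asymptotic_net : adapted_frame U x e1 e2 e3 k1 k2 ->
  (forall p, U p -> [/\ k1 p != 0, k1 p != k2 p & nabla1 x e1 e2 k1 p != 0]) ->
  asymptotic_net U x e1 e2 (central_surface x e3 k1)
    (Net (nabla1 x e1 e2 k1) (fun=> 0) (fun p => - nabla1 x e1 e2 k2 p)).
Proof.
move=> F nz; have F' := adapted_frameC F.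
split.
  move=> p Up; have [k0 k12 nk] := nz p Up.
  have [h1 [h2 [xh1 xh2 hd]]] := frame_basis F Up.
  have [dy Ey] := is_diff_central F Up k0.
  split=> // h; rewrite Ey => yh0.
  have [e11 e22] := adapted_unit F Up; have [e12 e13 e23] := adapted_orthogonal F Up.
  have [_ e33 _] := adapted_normal F Up.
  (* If dy (h) = 0, its e3-component gives dk1 (h) = 0 and its e2-component gives omega_2 (h) = 0,
     as k1 and k2 differ. Then nabla_1 k1 omega_1 (h) = 0 forces omega_1 (h) = 0. *)
  have k3 : 'd k1 p h = 0.
    have := congr1 (fun v => dot v (e3 p)) yh0.
    rewrite dotDl !dotZl e23 e33 mulr0 add0r mulr1.
    rewrite -(scale0r (0 : 'rV_3)) dotZl mul0r => /eqP; rewrite oppr_eq0 mulf_eq0.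
    by rewrite invr_eq0 expf_eq0 (negbTE k0) orbF => /eqP.
  have w2 : omega x e2 p h = 0.
    have := congr1 (fun v => dot v (e2 p)) yh0.
    rewrite dotDl !dotZl e22 k3 mul0r oppr0 mul0r mulr1 addr0.
    rewrite -(scale0r (0 : 'rV_3)) dotZl mul0r => /eqP; rewrite mulf_eq0 => /orP[|/eqP//].
    by rewrite subr_eq0 eq_sym => /eqP /divr1_eq /esym/eqP; rewrite (negbTE k12).
  move: k3; rewrite (diff_decomp hd) w2 mulr0 addr0 => /eqP; rewrite mulf_eq0.
  rewrite -(nablaE F Up xh1 xh2 hd k1).1 (negbTE nk) /= => /eqP w1.
  by rewrite [h]hd w1 w2 !scale0r addr0.
exists e1, (fun p => (k1 p)^-1); split.
  move=> p Up; have [k0 k12 nk] := nz p Up.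
  have [h1 [h2 [xh1 xh2 hd]]] := frame_basis F Up.
  have [dy Ey] := is_diff_central F Up k0.
  have [_ [d1 _] _ _] := adapted_class F.
  have [e11 _] := adapted_unit F Up; have [e12 e13 _] := adapted_orthogonal F Up.
  split; [exact: d1|by []|move=> h].
  by rewrite Ey dotDl !dotZl (dotC (e2 p)) (dotC (e3 p)) e12 e13 !mulr0 addr0.
move=> p Up; have [k0 k12 nk] := nz p Up; split; first by rewrite invr_eq0.
have [h1 [h2 [xh1 xh2 hd]]] := frame_basis F Up.
have [dy Ey] := is_diff_central F Up k0.
move=> h.
have [n11 _] := nablaE F Up xh1 xh2 hd k1.
have [n12 _] := nablaE F Up xh1 xh2 hd k2.
have [_ _ S3] := frame_skew h F Up.
have [_ S1 _] := frame_skew h2 F Up.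
have C1 := codazzi F Up xh1 xh2.
(* With the indices exchanged, the same equation expresses nabla_1 k2 by omega_12 (h2). *)
have C2 := codazzi F' Up xh2 xh1.
rewrite S1 in C2.
have S2 : dot (e2 p) ('d e1 p h) = omega x e1 p h * dot ('d e1 p h1) (e2 p)
    + omega x e2 p h * dot ('d e1 p h2) (e2 p).
  rewrite -!dotZl -dotDl dotC; congr (dot _ _).
  by rewrite {1}[h]hd linearD !linearZ.
have Y v : dot ('d (central_surface x e3 k1) p h) v
    = ((1 - k2 p / k1 p) * omega x e2 p h) * dot (e2 p) v
      + - ('d k1 p h / k1 p ^+ 2) * dot (e3 p) v by rewrite Ey dotDl !dotZl.
(* The form - dy . de1 equals (dk1 omega_1 - (k1 - k2) omega_12 omega_2) / k1; by Codazzi the mixed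
   terms nabla_2 k1 omega_1 omega_2 cancel. *)
rewrite /second_form (Y ('d e1 p h)) S2 S3 (diff_decomp hd k1) C1.
rewrite /net_form /= n11 n12 C2.
by field.
Qed.

End Central.

(** * Orthogonal and conjugate nets in terms of their coefficients *)

Section Directions.
Variable R : realType.
Implicit Types (N : net R) (p : R * R).
Local Open Scope complex_scope.

Lemma net_directions_mul N p d1 d2 : net_directions N p d1 d2 ->
  d1.1 * d2.1 = (netC N p)%:C /\ d1.2 * d2.2 = (netA N p)%:C.
Proof.
case=> _ _ dE; have := dE (0, 1); have := dE (1, 0) => /=.
rewrite !(expr0n, expr1n, mulr0, mul0r, mulr1, addr0, add0r, subr0, sub0r) /=.
by rewrite mulrNN => -> ->.
Qed.

(** A h1^2 + C h2^2 factors as A (h1 - s h2) (h1 + s h2) with s^2 = - C / A; the root s is complex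
    in general. *)
Lemma net_directions_ex N p : netB N p = 0 -> netA N p != 0 ->
  exists d1 d2, net_directions N p d1 d2.
Proof.
move=> B0 A0; pose A : R[i] := (netA N p)%:C; pose C : R[i] := (netC N p)%:C.
have AC0 : A != 0 by apply: contra A0 => /eqP/complexI ->.
pose s := sqrtc (- C / A); have s2 : C = - (A * s ^+ 2).
  by rewrite sqr_sqrtc; field.
exists (A * s, A), (- s, 1); split.
- by apply: contra AC0 => /eqP/(congr1 snd)/= ->.
- by apply/eqP => /(congr1 snd)/= /eqP; rewrite oner_eq0.
- by move=> h /=; rewrite B0 -/A -/C s2 rmorph0; ring.
Qed.

(** Common form of both conditions: a = b = 1 is orthogonality, a = k1 and b = k2 is conjugacy. *)
Lemma net_polar N p (a b : R) : netB N p = 0 -> a != 0 -> b != 0 ->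
  (netA N p != 0) || (netC N p != 0) ->
  (exists d1 d2, net_directions N p d1 d2 /\
     a%:C * (d1.1 * d2.1) + b%:C * (d1.2 * d2.2) = 0) <->
  a * netC N p + b * netA N p = 0.
Proof.
move=> B0 a0 b0 AC; split=> [[d1 [d2 [/net_directions_mul[-> ->]]]]|abE].
  by rewrite -!rmorphM -rmorphD => /complexI.
(* If A were 0, the relation would give C = 0 as well, and the form would vanish. *)
have A0 : netA N p != 0.
  apply/eqP => A0; move: AC abE; rewrite A0 eqxx mulr0 addr0 /= => C0 /eqP.
  by rewrite mulf_eq0 (negbTE a0) (negbTE C0).
have [d1 [d2 dE]] := net_directions_ex B0 A0.
exists d1, d2; split=> //; have [-> ->] := net_directions_mul dE.
by rewrite -!rmorphM -rmorphD abE.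
Qed.

Lemma orthogonal_netP (U : set (R * R)) N :
  (forall p, U p -> netB N p = 0 /\ ((netA N p != 0) || (netC N p != 0))) ->
  orthogonal_net U N <-> forall p, U p -> netC N p + netA N p = 0.
Proof.
move=> nz; split=> + p Up => /(_ p Up); have [B0 AC] := nz p Up;
  have := @net_polar N p 1 1 B0 (oner_neq0 _) (oner_neq0 _) AC;
  rewrite !mul1r => -[P Q].
- by move=> [d1 [d2 [dE dO]]]; apply: P; exists d1, d2; rewrite rmorph1 !mul1r.
- by move=> /Q [d1 [d2]]; rewrite rmorph1 !mul1r => -[dE dO]; exists d1, d2.
Qed.

Lemma conjugate_netP (U : set (R * R)) (k1 k2 : R * R -> R) N :
  (forall p, U p -> [/\ netB N p = 0, k1 p != 0, k2 p != 0 &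
     (netA N p != 0) || (netC N p != 0)]) ->
  conjugate_net U k1 k2 N <->
  forall p, U p -> k1 p * netC N p + k2 p * netA N p = 0.
Proof.
by move=> nz; split=> + p Up => /(_ p Up); have [B0 a0 b0 AC] := nz p Up;
  have [] := net_polar B0 a0 b0 AC.
Qed.

End Directions.

(** * Functional relations and exchange of the two indices *)

Lemma affine_weingarten (R : realType) (U : set (R * R)) (k1 k2 : R * R -> R)
  (a c : R) : (forall p, U p -> k1 p - a * k2 p = c) -> weingarten U k1 k2.
Proof.
move=> kE; pose Phi : R * R -> R := (fst - a *: snd) - cst c.
have linear_is_diff (f : R * R -> R) q : linear f -> continuous f -> is_diff q f f.
  move=> lf cf; pose L : {linear (R * R)%type -> R} :=
    HB.pack f (GRing.isLinear.Build _ _ _ _ f lf).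
  by apply: DiffDef; [exact: (@linear_differentiable _ _ _ L) | exact: (@diff_lin _ _ _ L)].
have dfst q : is_diff q (@fst R R) fst.
  by apply: linear_is_diff => // r; exact: cvg_fst.
have dsnd q : is_diff q (@snd R R) snd.
  by apply: linear_is_diff => // r; exact: cvg_snd.
have dPhi q : is_diff q Phi (fst - a *: snd).
  by apply: is_diff_eq; rewrite subr0.
exists setT, Phi; split; first exact: openT.
  split=> [q _|h q _]; first exact: ex_diff.
  have -> : (fun q => 'd Phi q h) = cst ((fst - a *: snd : R * R -> R) h).
    by apply/funext => r; have [_ ->] := dPhi r.
  exact: cst_continuous.
move=> p Up; split=> //.
  by rewrite -[LHS]/(k1 p - a * k2 p - c) kE// subrr.
exists (1, 0); have [_ ->] := dPhi (k1 p, k2 p).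
by rewrite -[X in X != _]/(1 - a * 0) mulr0 subr0 oner_neq0.
Qed.

Lemma nablaC (R : realType) (U : set (R * R)) (x e1 e2 e3 : R * R -> 'rV[R]_3)
    (k1 k2 f : R * R -> R) (p : R * R) :
  adapted_frame U x e1 e2 e3 k1 k2 -> U p ->
  nabla1 x e2 e1 f p = nabla2 x e1 e2 f p.
Proof.
move=> F Up; have [h1 [h2 [xh1 xh2 hd]]] := frame_basis F Up.
have hd' h : h = omega x e2 p h *: h2 + omega x e1 p h *: h1 by rewrite addrC.
by rewrite (nablaE F Up xh1 xh2 hd f).2 (nablaE (adapted_frameC F) Up xh2 xh1 hd' f).1.
Qed.

(** Exchanging e1 and e2 swaps the outer coefficients of a net; the remaining sign is absorbed into
    the factor c. This carries the first central surface over to the second. *)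
Lemma asymptotic_netC (R : realType) (U : set (R * R))
    (x e1 e2 y : R * R -> 'rV[R]_3) (M N : net R) :
  (forall p, U p -> [/\ netA N p = - netC M p, netB N p = - netB M p
                      & netC N p = - netA M p]) ->
  asymptotic_net U x e2 e1 y M -> asymptotic_net U x e1 e2 y N.
Proof.
move=> MN [iy [n [c [nn cE]]]]; split=> //; exists n, (fun p => - c p); split=> //.
move=> p Up; have [c0 yE] := cE p Up; split=> [|h]; first by rewrite oppr_eq0.
by rewrite yE /net_form; have [-> -> ->] := MN p Up; ring.
Qed.

Lemma cst_diff (R : realType) (V : normedModType R) (U : set V) (f g : V -> R)
    (a c : R) (p : V) : open U -> U p -> differentiable f p -> differentiable g p ->
  (forall q, U q -> f q - a * g q = c) -> forall h, 'd f p h = a * 'd g p h.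
Proof.
move=> oU Up df dg fgE h.
have D := is_diffD (is_diffZ a (differentiableP dg)) (is_diff_cst c p).
have [|_ E] := near_eq_is_diff (f := f) _ D.
  near=> q; have Uq : U q by near: q; exact: open_nbhs_nbhs.
  by rewrite -[RHS]/(a * g q + c) -(fgE q Uq) subrKC.
rewrite E -[LHS]/(a * 'd g p h + 0).
by rewrite addr0.
Unshelve. all: by end_near. Qed.

(** * Orthogonality and conjugacy of both nets *)

Unset Implicit Arguments.

Theorem proposition3 (R : realType) (r : nat) (U : set (R * R))
  (x e1 e2 e3 : R * R -> 'rV[R]_3) (k1 k2 : R * R -> R)
  (r_ge4 : (4 <= r)%N)
  (U_open : open U) (U_connected : connected U)
  (frame : principal_frame r U x e1 e2 e3 k1 k2)
  (no_parabolic : forall p, U p -> k1 p * k2 p != 0)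
  (not_canal : forall p, U p ->
     [/\ k1 p != k2 p, nabla1 x e1 e2 k1 p != 0 & nabla2 x e1 e2 k2 p != 0]) :
  let N1 := Net (nabla1 x e1 e2 k1) (fun=> 0)
                (fun p => - nabla1 x e1 e2 k2 p) in
  let N2 := Net (nabla2 x e1 e2 k1) (fun=> 0)
                (fun p => - nabla2 x e1 e2 k2 p) in
  [/\ asymptotic_net U x e1 e2 (central_surface x e3 k1) N1 /\
      asymptotic_net U x e1 e2 (central_surface x e3 k2) N2,
      (orthogonal_net U N1 /\ orthogonal_net U N2) <->
      (weingarten U k1 k2 /\
       exists c : R, forall p, U p -> k1 p - k2 p = c)
    & (conjugate_net U k1 k2 N1 /\ conjugate_net U k1 k2 N2) <->
      (weingarten U k1 k2 /\
       exists c : R, forall p, U p -> k1 p / k2 p = c)].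
Proof.
move=> N1 N2.
have F := principal_frame_adapted r_ge4 U_open frame.
have F' := adapted_frameC F.
have k1_neq0 p : U p -> k1 p != 0.
  by move=> /no_parabolic; rewrite mulf_eq0 => /norP[].
have k2_neq0 p : U p -> k2 p != 0.
  by move=> /no_parabolic; rewrite mulf_eq0 => /norP[].
have dk1 p : U p -> differentiable k1 p by move=> Up; exact: (differentiable_curvature F Up).
have dk2 p : U p -> differentiable k2 p by move=> Up; exact: (differentiable_curvature F' Up).
have nz1 p : U p -> (netA N1 p != 0) || (netC N1 p != 0).
  by move=> /not_canal[_ n1 _]; apply/orP; left.
have nz2 p : U p -> (netA N2 p != 0) || (netC N2 p != 0).
  by move=> /not_canal[_ _ n2]; apply/orP; right; rewrite /= oppr_eq0.
(* The coefficient conditions on both nets together amount to dk1 = a dk2 at p, with a = 1 for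
   orthogonality and a = k1 / k2 for conjugacy. *)
have nabla_lin (a : R) p : U p ->
    (forall h, 'd k1 p h = a * 'd k2 p h) <->
    nabla1 x e1 e2 k1 p = a * nabla1 x e1 e2 k2 p /\
    nabla2 x e1 e2 k1 p = a * nabla2 x e1 e2 k2 p.
  move=> Up; have [h1 [h2 [xh1 xh2 hd]]] := frame_basis F Up.
  have [-> ->] := nablaE F Up xh1 xh2 hd k1.
  have [-> ->] := nablaE F Up xh1 xh2 hd k2.
  split=> [kE|[E1 E2] h]; first by split; exact: kE.
  have comb (A B C D w1 w2 : R) : A = a * C -> B = a * D ->
    A * w1 + B * w2 = a * (C * w1 + D * w2) by move=> -> ->; ring.
  apply: etrans (diff_decomp hd k1 h) _.
  exact: etrans (comb _ _ _ _ _ _ E1 E2) (congr1 _ (esym (diff_decomp hd k2 h))).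
split.
- split.
    apply: central_asymptotic_net F _ => p Up.
    by have [k12 n1 _] := not_canal p Up; split=> //; exact: k1_neq0.
  apply: asymptotic_netC (central_asymptotic_net F' _) => p Up /=.
    by rewrite !(nablaC _ F Up) oppr0 opprK.
  have [k12 _ n2] := not_canal p Up.
  by rewrite (nablaC _ F Up); split; [exact: k2_neq0|rewrite eq_sym|].
- rewrite !orthogonal_netP; [|by move=> p /nz2|by move=> p /nz1].
  split=> [[A1 A2]|[_ [c cE]]].
    have [|c cE] := diff0_cst (g := k1 - k2) U_open U_connected.
      move=> p Up.
      have D := is_diffB (differentiableP (dk1 p Up)) (differentiableP (dk2 p Up)).
      apply: is_diff_eq D _.
      have eq_of_sum0 (a b : R) : - b + a = 0 -> a = 1 * b by lra.
      have dE : forall h, 'd k1 p h = 1 * 'd k2 p h.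
        by apply/nabla_lin => //; split; apply: eq_of_sum0; [exact: A1|exact: A2].
      apply/funext => h; rewrite -[LHS]/('d k1 p h - 'd k2 p h) (dE h).
      by rewrite mul1r subrr.
    split; last by exists c.
    by apply: (@affine_weingarten _ _ _ _ 1 c) => p Up; rewrite mul1r; exact: cE.
  have cE1 q : U q -> k1 q - 1 * k2 q = c by move=> Uq; rewrite mul1r cE.
  have N0 p : U p -> nabla1 x e1 e2 k1 p = 1 * nabla1 x e1 e2 k2 p /\
      nabla2 x e1 e2 k1 p = 1 * nabla2 x e1 e2 k2 p.
    move=> Up; apply/nabla_lin => //.
    exact: cst_diff U_open Up (dk1 p Up) (dk2 p Up) cE1.
  by split=> p /N0 /= [E1 E2]; rewrite ?E1 ?E2 mul1r addNr.
- rewrite !conjugate_netP.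
  + split=> [[A1 A2]|[_ [c cE]]].
      (* From dk1 = (k1 / k2) dk2 the two terms of d (k1 / k2) cancel. *)
      have [|c cE] := diff0_cst (g := k1 * (fun q => (k2 q)^-1)) U_open U_connected.
        move=> p Up; have k20 := k2_neq0 p Up.
        have D := is_diffM (differentiableP (dk1 p Up))
          (differentiableP (differentiableV (dk2 p Up) k20)).
        have eq_of_sum0 (a b : R) : k1 p * - b + k2 p * a = 0 -> a = k1 p / k2 p * b.
          move=> ab0; apply: (mulfI k20).
          have -> : k2 p * (k1 p / k2 p * b) = k1 p * b by field.
          by lra.
        have dE : forall h, 'd k1 p h = k1 p / k2 p * 'd k2 p h.
          by apply/nabla_lin => //; split; apply: eq_of_sum0; [exact: A1|exact: A2].
        have comb (A B d : R) : A = - (k2 p) ^- 2 * d -> B = k1 p / k2 p * d ->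
          k1 p * A + (k2 p)^-1 * B = 0 by move=> -> ->; field.
        apply: is_diff_eq D _; apply/funext => h.
        have EV : 'd (fun q => (k2 q)^-1) p h = - (k2 p) ^- 2 * 'd k2 p h.
          by rewrite (diffV (dk2 p Up) k20).
        exact: comb EV (dE h).
      split; last by exists c.
      (* A constant ratio c is read as the affine relation k1 - c k2 = 0, here and in the
         converse. *)
      apply: (@affine_weingarten _ _ _ _ c 0) => p Up.
      by rewrite -(cE p Up) -[(k1 * _) p]/(k1 p / k2 p) mulfVK ?k2_neq0// subrr.
    have cE0 q : U q -> k1 q - c * k2 q = 0.
      by move=> Uq; rewrite -(cE q Uq) mulfVK ?k2_neq0// subrr.
    have N0 p : U p -> nabla1 x e1 e2 k1 p = c * nabla1 x e1 e2 k2 p /\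
        nabla2 x e1 e2 k1 p = c * nabla2 x e1 e2 k2 p.
      move=> Up; apply/nabla_lin => //.
      exact: cst_diff U_open Up (dk1 p Up) (dk2 p Up) cE0.
    have kE p : U p -> k1 p = c * k2 p by move=> /cE0 /subr0_eq.
    split=> p Up /=; have [E1 E2] := N0 p Up; rewrite (kE p Up).
      by rewrite E1; ring.
    by rewrite E2; ring.
  + by move=> p Up; split; [|exact: k1_neq0|exact: k2_neq0|exact: nz2].
  + by move=> p Up; split; [|exact: k1_neq0|exact: k2_neq0|exact: nz1].
Qed.
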